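(* Let $n\ge 1$, let $H,L\in\mathbb{R}^{n\times n}$, $F\in\mathbb{R}^{n\times 1}$, and let $\alpha\in\mathbb{R}$. Let $\lambda_1,\dots,\lambda_n\in\mathbb{C}$ be numbers each of which is either real or occurs together with its complex conjugate (that is, the list $\lambda_1,\dots,\lambda_n$, with multiplicities, is closed under complex conjugation). Put $G=H+\alpha L$ and assume that the pair $(G,F)$ is completely controllable, i.e. the matrix $\begin{bmatrix}F & GF & \cdots & G^{n-1}F\end{bmatrix}$ is invertible. Define $a=\begin{bmatrix}a_{n-1}^* & \cdots & a_1^* & a_0^*\end{bmatrix}$ by $$\prod_{i=1}^n(\beta-\lambda_i)=\beta^n+a_{n-1}^*\beta^{n-1}+\cdots+a_1^*\beta+a_0^*,$$ and define $$b=-\begin{bmatrix}0&\cdots&0&1\end{bmatrix}\begin{bmatrix}F & GF & \cdots & G^{n-1}F\end{bmatrix}^{-1},\qquad D=\begin{bmatrix}(bG^{n-1})' & \cdots & (bG)' & b'\end{bmatrix}'.$$ Then with the gains $K_u=\alpha I$ and $K_v=aD+bG^n\in\mathbb{R}^{1\times n}$, the spectrum of the operator $$\mathcal{L}(X)=(H+LK_u+FK_v)\,X\,(H+LK_u+FK_v)'+K_uXK_u'$$ is the desired set: $$\sigma(\mathcal{L})=\{\lambda_i\lambda_j+\alpha^2:\ 1\le i\le j\le n\}.$$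
   Context: $A'$ denotes the transpose (without complex conjugation) of $A$, and $I$ is the $n\times n$ identity matrix. The operator $\mathcal{L}$ arises from the discrete-time stochastic system $x(k+1)=Hx(k)+Lu(k)+Fv(k)+u(k)w(k)$, with state $x(k)\in\mathbb{R}^n$, controls $u(k)\in\mathbb{R}^n$ and $v(k)\in\mathbb{R}$, and scalar white noise $w(k)$, under the state feedback $u(k)=K_ux(k)$, $v(k)=K_vx(k)$. The operator $\mathcal{L}$ acts on the space of $n\times n$ symmetric matrices $X$ ($X'=X$) with complex entries, and its spectrum is $$\sigma(\mathcal{L})=\{\mu\in\mathbb{C}:\ \mathcal{L}(X)=\mu X\text{ for some symmetric } X\ne 0\}.$$ *)

(* Defs.v *)
From HB Require Import structures.
From mathcomp Require Import all_boot all_order all_algebra.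
From mathcomp Require Import all_classical all_reals.
From mathcomp Require Import complex.

Set Implicit Arguments.
Unset Strict Implicit.
Unset Printing Implicit Defensive.

Import Order.TTheory GRing.Theory Num.Theory.
Local Open Scope ring_scope.
Local Open Scope classical_set_scope.

Definition complex_mx (R : rcfType) (m n : nat) (A : 'M[R]_(m, n)) :
  'M[R[i]]_(m, n) := map_mx (real_complex R) A.

Definition controllability_mx (K : comUnitRingType) (n : nat)
  (G : 'M[K]_n) (F : 'cV[K]_n) : 'M[K]_n :=
  \matrix_(i < n, j < n) (G ^+ j *m F) i 0.

Definition completely_controllable (K : comUnitRingType) (n : nat)
  (G : 'M[K]_n) (F : 'cV[K]_n) : bool :=
  controllability_mx G F \in unitmx.

Definition last_unit_row (K : comUnitRingType) (n : nat) : 'rV[K]_n :=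
  \row_(j < n) (j.+1 == n)%:R.

Definition gain_b (K : comUnitRingType) (n : nat)
  (G : 'M[K]_n) (F : 'cV[K]_n) : 'rV[K]_n :=
  - (last_unit_row K n *m invmx (controllability_mx G F)).

(* From top to bottom the rows are b G^(n-1), ..., b G, b. *)
Definition gain_D (K : comUnitRingType) (n : nat)
  (G : 'M[K]_n) (b : 'rV[K]_n) : 'M[K]_n :=
  \matrix_(i < n) (b *m G ^+ (n.-1 - i)).

(* Non-leading coefficients of \prod_i ('X - lambda_i), a monic polynomial of
   degree n, listed from degree n-1 down to degree 0. *)
Definition gain_a (K : comUnitRingType) (n : nat) (lambda : n.-tuple K) :
  'rV[K]_n :=
  \row_(j < n) (\prod_(x <- lambda) ('X - x%:P))`_(n.-1 - j).

Definition feedback_operator (K : comUnitRingType) (n : nat)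
  (H L : 'M[K]_n) (F : 'cV[K]_n) (Ku : 'M[K]_n) (Kv : 'rV[K]_n)
  (X : 'M[K]_n) : 'M[K]_n :=
  (H + L *m Ku + F *m Kv) *m X *m (H + L *m Ku + F *m Kv)^T
  + Ku *m X *m Ku^T.

(* The spectrum of [T] as an operator on symmetric matrices: eigenvectors are
   required to be symmetric. *)
Definition sym_spectrum (K : comUnitRingType) (n : nat)
  (T : 'M[K]_n -> 'M[K]_n) : set K :=
  [set mu | exists X : 'M[K]_n, [/\ X^T = X, X != 0 & T X = mu *: X]].

(* Main.v *)
(* Let p be the product of the X - lambda_i, so that K_v = b p(G) and the closed
   loop matrix is A = G + F b p(G).  By definition of b, b G^j F is 0 for
   j < n - 1 and -1 for j = n - 1; hence b is cyclic for G, b A^k = b G^k for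
   k < n, and b p(A) = 0.  By Cayley-Hamilton b also kills the characteristic
   polynomial of A; the difference of these monic polynomials has degree < n, so
   it vanishes by cyclicity.
   The operator is X |-> A X A' + alpha^2 X.  If A X A' = nu X with X != 0, some
   partial product of the A - lambda_i maps X to Y != 0 with A Y = lambda_i Y and
   A Y A' = nu Y; doing the same on the right gives nu = lambda_i lambda_j.
   Conversely u v' + v u' (or u u' if lambda_i = lambda_j) is a symmetric
   eigenvector when u, v are eigenvectors of A for lambda_i, lambda_j. *)
Require Import Defs.
From HB Require Import structures.
From mathcomp Require Import all_boot all_order all_algebra.
From mathcomp Require Import all_classical all_reals.
From mathcomp Require Import complex.
From mathcomp Require Import zify.

Set Implicit Arguments.
Unset Strict Implicit.
Unset Printing Implicit Defensive.

Import Order.TTheory GRing.Theory Num.Theory.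
Local Open Scope ring_scope.
Local Open Scope classical_set_scope.

(** * Pole placement for the single-input pair [(G, F)] over a field *)

Lemma horner_mx_sum (K : fieldType) (n m : nat) (A : 'M[K]_n.+1)
    (p : {poly K}) : (size p <= m)%N ->
  horner_mx A p = \sum_(i < m) p`_i *: A ^+ i.
Proof.
move=> le_p; rewrite [in LHS](_ : p = \poly_(i < m) p`_i); last first.
  apply/polyP=> i; rewrite coef_poly; case: ltnP => // le_i.
  by rewrite nth_default // (leq_trans le_p).
rewrite poly_def rmorph_sum /=; apply: eq_bigr => i _.
by rewrite horner_mxZ rmorphXn /= horner_mx_X.
Qed.

Section PolePlacement.

Variables (K : fieldType) (n : nat) (G : 'M[K]_n.+1) (F : 'cV[K]_n.+1).
Hypothesis ctrlGF : completely_controllable G F.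

Let b := gain_b G F.

Lemma gain_b_markov (j : 'I_n.+1) : b *m G ^+ j *m F = (- (j.+1 == n.+1)%:R)%:M.
Proof.
rewrite [LHS]mx11_scalar; congr _%:M.
(* [G ^+ j *m F] is column [j] of the controllability matrix, whose inverse has [- b] as its last
   row. *)
have -> : (b *m G ^+ j *m F) 0 0 = (b *m controllability_mx G F) 0 j.
  rewrite -mulmxA [LHS]mxE [RHS]mxE; apply: eq_bigr => k _.
  by rewrite [X in _ = _ * X]mxE.
by rewrite mulNmx mulmxKV // !mxE.
Qed.

Lemma gain_b_horner (r : {poly K}) : (size r <= n.+1)%N ->
  b *m horner_mx G r *m F = (- r`_n)%:M.
Proof.
move=> le_r; rewrite (horner_mx_sum _ le_r) mulmx_sumr mulmx_suml.
transitivity (\sum_(i < n.+1) (- (r`_i * (i.+1 == n.+1)%:R))%:M : 'M[K]_1).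
  apply: eq_bigr => i _.
  by rewrite -scalemxAr -scalemxAl gain_b_markov scale_scalar_mx mulrN.
rewrite big_ord_recr /= eqxx mulr1 big1 ?add0r // => i _.
by rewrite eqSS ltn_eqF // mulr0 oppr0 raddf0.
Qed.

Lemma gain_b_cyclic (r : {poly K}) : (size r <= n.+1)%N ->
  b *m horner_mx G r = 0 -> r = 0.
Proof.
move=> le_r br0; apply/eqP; apply: contraT => r_neq0.
have szr : (0 < size r)%N by rewrite size_poly_gt0.
(* The shift moves the leading coefficient of [r] to degree [n], the one that [gain_b_horner] reads
   off, while [b] still annihilates [horner_mx G s]. *)
pose s := r * 'X^(n.+1 - size r).
have le_s : (size s <= n.+1)%N.
  by rewrite size_mulXn // addnC subnKC.
have := gain_b_horner le_s.
rewrite rmorphM /= mulmxA br0 !mul0mx => /matrixP/(_ 0 0)/eqP.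
rewrite !mxE eqxx mulr1n eq_sym oppr_eq0 coefMXn ltnNge.
have -> : (n.+1 - size r <= n)%N by rewrite leq_subLR -ltnS -addSn; lia.
have -> : (n - (n.+1 - size r))%N = (size r).-1 by lia.
by rewrite -[r`_ _]/(lead_coef r) lead_coef_eq0 (negPf r_neq0).
Qed.

Variable p : {poly K}.
Hypotheses (p_monic : p \is monic) (szp : size p = n.+2).

Let A := G + F *m (b *m horner_mx G p).

(** In the step from [k] to [k.+1] the feedback enters through the factor [b *m G ^+ k *m F], which
    is zero because [k < n]. *)
Lemma gain_b_closed_loop (k : nat) : (k <= n)%N -> b *m A ^+ k = b *m G ^+ k.
Proof.
elim: k => [|k IH] lt_k; first by rewrite !expr0.
rewrite !exprSr -!mulmxE mulmxA IH ?(ltnW lt_k) // /A mulmxDr !mulmxA.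
have /= := gain_b_markov (Ordinal (leqW lt_k)) => ->.
by rewrite eqSS ltn_eqF // oppr0 raddf0 !mul0mx addr0.
Qed.

Lemma gain_b_horner_closed_loop (r : {poly K}) : (size r <= n.+1)%N ->
  b *m horner_mx A r = b *m horner_mx G r.
Proof.
move=> le_r; rewrite !(horner_mx_sum _ le_r) !mulmx_sumr.
apply: eq_bigr => i _.
by rewrite -!scalemxAr gain_b_closed_loop // -ltnS.
Qed.

(** The part of [p] below degree [n.+1] does not see the feedback. In degree [n.+1] it does:
    [b *m G ^+ n *m F] is -1, so b A^(n+1) = b G^(n+1) - b p(G), and the sum is b p(G) - b p(G). *)
Lemma gain_b_annihilates : b *m horner_mx A p = 0.
Proof.
pose r := p - 'X^(n.+1).
have Dp : p = r + 'X^(n.+1) by rewrite subrK.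
have le_r : (size r <= n.+1)%N.
  apply/leq_sizeP => j; rewrite leq_eqVlt coefB coefXn => /predU1P[<-|lt_j].
    by rewrite eqxx -(monicP p_monic) lead_coefE szp subrr.
  by rewrite gtn_eqF // subr0 nth_default ?szp.
rewrite {1}Dp rmorphD /= rmorphXn /= horner_mx_X mulmxDr.
rewrite gain_b_horner_closed_loop // exprSr -mulmxE mulmxA gain_b_closed_loop //.
rewrite {1}/A mulmxDr !mulmxA.
have /= := gain_b_markov ord_max => ->.
rewrite eqxx mul_scalar_mx scaleN1r -mulmxA mulmxE -exprSr addrCA.
have : b *m horner_mx G p = b *m horner_mx G r + b *m G ^+ n.+1.
  by rewrite {1}Dp rmorphD /= rmorphXn /= horner_mx_X mulmxDr.
by move=> bp; rewrite (mulNmx b) bp opprD addNKr addrN.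
Qed.

Lemma char_poly_closed_loop : char_poly A = p.
Proof.
have le_d : (size (p - char_poly A)%R <= n.+1)%N.
  apply/leq_sizeP => j; rewrite leq_eqVlt coefB => /predU1P[<-|lt_j].
    have := monicP (char_poly_monic A); rewrite lead_coefE size_char_poly /= => ->.
    by rewrite -(monicP p_monic) lead_coefE szp subrr.
  by rewrite !nth_default ?szp ?size_char_poly ?subrr.
apply/esym/eqP; rewrite -subr_eq0; apply/eqP/gain_b_cyclic => //.
rewrite -gain_b_horner_closed_loop // rmorphB /= Cayley_Hamilton subr0.
exact: gain_b_annihilates.
Qed.

End PolePlacement.

(** Ackermann's formula: the coefficients in [a] and the rows of [D] both run by decreasing degree,
    so their product is the non-leading part of b p(G). *)
Lemma gain_feedbackE (K : fieldType) (n : nat) (lambda : n.+1.-tuple K)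
    (G : 'M[K]_n.+1) (b : 'rV[K]_n.+1) :
  gain_a lambda *m gain_D G b + b *m G ^+ n.+1
  = b *m horner_mx G (\prod_(x <- lambda) ('X - x%:P)).
Proof.
set p := \prod_(x <- _) _.
have szp : size p = n.+2 by rewrite size_prod_XsubC size_tuple.
have p_monic : p \is monic by exact: monic_prod_XsubC.
rewrite (@horner_mx_sum _ _ n.+2) ?szp // big_ord_recr /= mulmxDr.
have -> : p`_n.+1 = 1 by rewrite -(monicP p_monic) lead_coefE szp.
rewrite scale1r; congr (_ + _).
rewrite mulmx_sum_row mulmx_sumr (reindex_inj rev_ord_inj) /=.
apply: eq_bigr => i _.
rewrite !mxE rowK /= -scalemxAr.
by have -> : (n - (n.+1 - i.+1))%N = i by have := ltn_ord i; lia.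
Qed.

(** * Eigenvalues of the congruence X |-> A X A' *)

Lemma foldr_sub_eigen (K : fieldType) (V : lmodType K) (f : V -> V)
    (S : V -> Prop) (S_stable : forall c y, S y -> S (f y - c *: y))
    (s : seq K) (x : V) :
  S x -> x != 0 -> foldr (fun c y => f y - c *: y) x s = 0 ->
  exists2 c, c \in s & exists y, [/\ S y, y != 0 & f y = c *: y].
Proof.
move=> Sx x_neq0; elim: s => [/eqP|c s IH] /=; first by rewrite (negPf x_neq0).
set y := foldr _ _ _.
have Sy : S y by rewrite /y; elim: (s) => //= d t; apply: S_stable.
have [y0 _|y_neq0 fy] := eqVneq y 0.
  by have [d ds yP] := IH y0; exists d; rewrite // inE ds orbT.
exists c; first exact: mem_head.
by exists y; split=> //; apply/eqP; rewrite -subr_eq0 fy.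
Qed.

Lemma foldr_mulmx (K : fieldType) (n : nat) (A X : 'M[K]_n.+1) (s : seq K) :
  foldr (fun c Y => A *m Y - c *: Y) X s
  = horner_mx A (\prod_(x <- s) ('X - x%:P)) *m X.
Proof.
elim: s => [|c s IH] /=; first by rewrite big_nil rmorph1 mul1mx.
rewrite IH big_cons rmorphM rmorphB /= horner_mx_X horner_mx_C -mulmxE.
by rewrite -mulmxA mulmxBl mul_scalar_mx.
Qed.

(** The eigenvalues of [A] are given as a list [s] with multiplicities, so that Cayley-Hamilton
    becomes a product of linear factors that can be applied one at a time. *)
Section CongruenceOperator.

Variables (K : fieldType) (n : nat) (A : 'M[K]_n.+1) (s : seq K).
Hypothesis chA : char_poly A = \prod_(x <- s) ('X - x%:P).

Lemma mulmx_eigen (S : 'M[K]_n.+1 -> Prop) (X : 'M[K]_n.+1) :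
  (forall c Y, S Y -> S (A *m Y - c *: Y)) -> S X -> X != 0 ->
  exists2 c, c \in s & exists Y, [/\ S Y, Y != 0 & A *m Y = c *: Y].
Proof.
move=> S_stable SX X_neq0; apply: (foldr_sub_eigen S_stable SX X_neq0).
by rewrite foldr_mulmx -chA Cayley_Hamilton mul0mx.
Qed.

Lemma congr_eigen (nu : K) (X : 'M[K]_n.+1) :
  X != 0 -> A *m X *m A^T = nu *: X ->
  exists x y, [/\ x \in s, y \in s & nu = x * y].
Proof.
move=> X_neq0 AXA.
(* The invariant survives because left multiplication by A - c commutes with X |-> A X A'. *)
have [c Y SY|x xs [Y [AYA Y_neq0 AY]]] :=
  @mulmx_eigen (fun Y => A *m Y *m A^T = nu *: Y) X _ AXA X_neq0.
  rewrite mulmxBr mulmxBl -[A *m (A *m Y) *m _]mulmxA SY.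
  by rewrite -!scalemxAr -scalemxAl SY scalerBr !scalerA mulrC.
(* With A Y = x Y the relation A Y A' = nu Y transposes to x A Y' = nu Y'. It is kept undivided by
   [x], so [x = 0] needs no separate case. *)
have [c Z SZ|||y ys [Z [ZA Z_neq0 AZ]]] :=
  @mulmx_eigen (fun Z => x *: (A *m Z) = nu *: Z) Y^T.
- rewrite mulmxBr -scalemxAr scalerBr [x *: (A *m (A *m Z))]scalemxAr SZ.
  by rewrite -scalemxAr scalerA mulrC -scalerA SZ scalerBr !scalerA mulrC.
- by rewrite -[A]trmxK -trmx_mul -linearZ /= scalemxAl -AY AYA linearZ.
- by rewrite -trmx0 (inj_eq trmx_inj).
exists x, y; split=> //; apply/esym/eqP; rewrite -subr_eq0.
have /eqP : x * y *: Z = nu *: Z by rewrite -scalerA -AZ.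
by rewrite -subr_eq0 -scalerBl scaler_eq0 (negPf Z_neq0) orbF.
Qed.

(** [eigenvalue] speaks of row vectors, hence the detour through [A^T], which has the same
    characteristic polynomial. *)
Lemma col_eigenvector (x : K) : x \in s ->
  exists2 u : 'cV[K]_n.+1, u != 0 & A *m u = x *: u.
Proof.
move=> xs.
have chAT : char_poly A^T = char_poly A.
  rewrite /char_poly -[RHS]det_tr; congr (\det _); apply/matrixP=> i j.
  by rewrite !mxE eq_sym.
have : eigenvalue A^T x by rewrite eigenvalue_root_char chAT chA root_prod_XsubC.
case/eigenvalueP=> v vA v_neq0; exists v^T.
  by rewrite -trmx0 (inj_eq trmx_inj).
by rewrite -[A]trmxK -trmx_mul vA linearZ.
Qed.

Lemma outer_neq0 (u v : 'cV[K]_n.+1) : u != 0 -> v != 0 -> u *m v^T != 0.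
Proof.
case/cV0Pn=> i ui /cV0Pn[j vj]; apply/eqP=> /matrixP/(_ i j)/eqP.
by rewrite !mxE big_ord1 !mxE mulf_eq0 (negPf ui) (negPf vj).
Qed.

Lemma congr_eigen_sym (x y : K) : x \in s -> y \in s ->
  exists X : 'M[K]_n.+1,
    [/\ X^T = X, X != 0 & A *m X *m A^T = (x * y) *: X].
Proof.
move=> /col_eigenvector[u u_neq0 Au] /col_eigenvector[v v_neq0 Av].
have AuA (a b : K) (w z : 'cV[K]_n.+1) : A *m w = a *: w -> A *m z = b *: z ->
    A *m (w *m z^T) *m A^T = (a * b) *: (w *m z^T).
  move=> Aw Az; rewrite mulmxA Aw -mulmxA -trmx_mul Az linearZ /=.
  by rewrite -scalemxAl -scalemxAr scalerA.
have [xy|neq_xy] := eqVneq x y.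
  exists (u *m u^T); split; first by rewrite trmx_mul trmxK.
    exact: outer_neq0.
  by rewrite -xy; apply: AuA.
exists (u *m v^T + v *m u^T); split.
- by rewrite linearD /= !trmx_mul !trmxK addrC.
(* If v u' = - u v', applying [A] on the left to the zero sum gives (x - y) u v' = 0, against
   [x != y]. *)
- apply/eqP=> uv0.
  have Duv : v *m u^T = - (u *m v^T) by apply/eqP; rewrite -addr_eq0 addrC uv0.
  have /eqP : A *m (u *m v^T + v *m u^T) = 0 by rewrite uv0 mulmx0.
  rewrite mulmxDr !mulmxA Au Av -!scalemxAl Duv scalerN -scalerBl scaler_eq0.
  by rewrite subr_eq0 (negPf neq_xy) (negPf (outer_neq0 u_neq0 v_neq0)).
- by rewrite mulmxDr mulmxDl (AuA x y) // (AuA y x) // scalerDr [y * x]mulrC.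
Qed.

End CongruenceOperator.

(** * From the congruence to the feedback operator, a shift by [alpha ^+ 2] *)

Lemma sym_spectrum_feedback (K : fieldType) (n : nat) (H L : 'M[K]_n.+1)
    (F : 'cV[K]_n.+1) (alpha : K) (Kv : 'rV[K]_n.+1)
    (lambda : n.+1.-tuple K) :
  char_poly (H + alpha *: L + F *m Kv) = \prod_(x <- lambda) ('X - x%:P) ->
  sym_spectrum (feedback_operator H L F alpha%:M Kv)
  = [set mu | exists i j : 'I_n.+1, (i <= j)%N /\
       mu = tnth lambda i * tnth lambda j + alpha ^+ 2].
Proof.
set A := _ + F *m Kv => chA.
have opE X : feedback_operator H L F alpha%:M Kv X
    = A *m X *m A^T + alpha ^+ 2 *: X.
  rewrite /feedback_operator mul_mx_scalar -/A tr_scalar_mx mul_mx_scalar.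
  by rewrite mul_scalar_mx scalerA expr2.
apply/seteqP; split=> mu /=.
  case=> X [_ X_neq0]; rewrite opE => /esym/eqP; rewrite -subr_eq -scalerBl.
  move=> /eqP/esym/(congr_eigen chA X_neq0)[x [y [/tnthP[i ->] /tnthP[j ->]]]].
  move=> /eqP; rewrite subr_eq => /eqP ->.
  have [le_ij|/ltnW le_ji] := leqP i j; first by exists i, j.
  by exists j, i; rewrite [tnth lambda j * _]mulrC.
case=> i [j [_ ->]].
have [X [symX X_neq0 AXA]] :=
  congr_eigen_sym chA (mem_tnth i lambda) (mem_tnth j lambda).
by exists X; split=> //; rewrite opE AXA scalerDl.
Qed.

(** * Passage from the real data to the complex field, and reality of the gain *)

Lemma map_controllability_mx (K K' : fieldType) (f : {rmorphism K -> K'})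
    (n : nat) (G : 'M[K]_n.+1) (F : 'cV[K]_n.+1) :
  map_mx f (controllability_mx G F)
  = controllability_mx (map_mx f G) (map_mx f F).
Proof.
by apply/matrixP=> i j; rewrite !mxE rmorph_sum /=; apply: eq_bigr => k _;
  rewrite -rmorphXn /= !mxE rmorphM.
Qed.

Lemma map_gain_b (K K' : fieldType) (f : {rmorphism K -> K'})
    (n : nat) (G : 'M[K]_n.+1) (F : 'cV[K]_n.+1) :
  map_mx f (gain_b G F) = gain_b (map_mx f G) (map_mx f F).
Proof.
rewrite /gain_b map_mxN map_mxM map_invmx map_controllability_mx.
by congr (- (_ *m _)); apply/rowP=> j; rewrite !mxE rmorph_nat.
Qed.

Lemma map_gain_D (K K' : fieldType) (f : {rmorphism K -> K'})
    (n : nat) (G : 'M[K]_n.+1) (b : 'rV[K]_n.+1) :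
  map_mx f (gain_D G b) = gain_D (map_mx f G) (map_mx f b).
Proof.
by apply/row_matrixP=> i; rewrite -map_row !rowK map_mxM /= rmorphXn.
Qed.

(** Conjugation permutes the roots, so it fixes their monic polynomial and thereby each
    coefficient. *)
Lemma gain_a_real (C : numClosedFieldType) (n : nat) (lambda : n.-tuple C) :
  perm_eq [seq Num.conj x | x <- lambda] lambda ->
  gain_a lambda \is a mxOver Num.real.
Proof.
move=> lambda_conj; apply/mxOverP=> i j; rewrite mxE; apply/CrealP.
rewrite -[LHS]coef_map /= map_prod_XsubC.
rewrite -(big_map _ xpredT (fun x => 'X - x%:P)).
by rewrite (perm_big _ lambda_conj).
Qed.

Lemma complex_mx_real (R : rcfType) (m n : nat) (A : 'M[R]_(m, n)) :
  complex_mx A \is a mxOver Num.real.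
Proof.
by apply/mxOverP=> i j; rewrite mxE; apply/complex_realP; exists (A i j).
Qed.

Theorem theorem1 (R : realType) (n : nat) (hn : (1 <= n)%N)
    (H L : 'M[R]_n) (F : 'cV[R]_n) (alpha : R)
    (lambda : n.-tuple R[i])
    (lambda_conj : perm_eq [seq Num.conj x | x <- lambda] lambda)
    (hGF : completely_controllable (H + alpha *: L) F) :
  let G := H + alpha *: L in
  let a := gain_a lambda in
  let b := gain_b G F in
  let D := gain_D G b in
  let Ku : 'M[R]_n := alpha%:M in
  let Kv : 'rV[R[i]]_n := a *m complex_mx D + complex_mx (b *m G ^+ n) in
  Kv \is a mxOver Num.real /\
  sym_spectrum (feedback_operator (complex_mx H) (complex_mx L) (complex_mx F)
                  (complex_mx Ku) Kv)
  = [set mu | exists i j : 'I_n, (i <= j)%N /\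
       mu = tnth lambda i * tnth lambda j + real_complex R (alpha ^+ 2)].
Proof.
move=> G a b D Ku Kv; split.
  apply/mxOverP=> i j; rewrite mxE; apply: rpredD; last first.
    exact/mxOverP/complex_mx_real.
  by move: i j; apply/mxOverP/mxOverM; rewrite ?gain_a_real ?complex_mx_real.
case: n hn H L F lambda lambda_conj hGF @G @a @b @D @Ku @Kv => // n _.
move=> H L F lambda _ hGF G a b D Ku Kv.
(* Pole placement is carried out over [R[i]], where the [lambda] live, so the real [b] and [D] are
   first rewritten as the gains of the complexified pair. *)
have KvE : Kv = gain_b (complex_mx G) (complex_mx F)
    *m horner_mx (complex_mx G) (\prod_(x <- lambda) ('X - x%:P)).
  by rewrite -gain_feedbackE -map_gain_b -map_gain_D /Kv /complex_mx map_mxM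
    /= rmorphXn.
have GE : complex_mx G = complex_mx H + real_complex R alpha *: complex_mx L.
  by rewrite /complex_mx map_mxD map_mxZ.
rewrite /complex_mx map_scalar_mx rmorphXn; apply: sym_spectrum_feedback.
rewrite -GE KvE char_poly_closed_loop //.
- by rewrite /completely_controllable -map_controllability_mx map_unitmx.
- exact: monic_prod_XsubC.
- by rewrite size_prod_XsubC size_tuple.
Qed.
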